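(* $P_h(\mathbb{S}^1)=\{0,1,2,3,\ldots\}\cup\{+\infty\}$, where $\mathbb{S}^1=\{e^{2\pi i\theta}:\theta\in[0,1]\}$ is the unit circle.
   Context: For a topological space $A$, $Homeo(A)$ denotes the group of all homeomorphisms $A\to A$ under composition. For a subgroup $G$ of $Homeo(A)$ (acting by $gx=g(x)$), a nonempty subset $Y\subseteq A$ is invariant if $g(y)\in Y$ for all $g\in G$, $y\in Y$. The height of $(G,A)$ is $h(G,A)=\sup\{n\geq 0:$ there exist distinct closed invariant subsets $Y_0\subset Y_1\subset\cdots\subset Y_n=A\}$ (possibly $+\infty$). Finally $P_h(A)=\{h(G,A): G \text{ is a subgroup of } Homeo(A)\}$. *)

(* Defs.v *)
From HB Require Import structures.
From mathcomp Require Import all_boot all_order all_algebra.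
From mathcomp Require Import all_classical all_reals all_analysis.
Set Implicit Arguments. Unset Strict Implicit. Unset Printing Implicit Defensive.
Import Order.TTheory GRing.Theory Num.Theory.
Import numFieldNormedType.Exports.
Local Open Scope classical_set_scope.
Local Open Scope ring_scope.

Definition homeomorphism (A : topologicalType) (f : A -> A) : Prop :=
  continuous f /\ exists g : A -> A, [/\ continuous g, cancel f g & cancel g f].

Definition homeo_subgroup (A : topologicalType) (G : set (A -> A)) : Prop :=
  [/\ G `<=` [set f | homeomorphism f],
      G id,
      (forall f g, G f -> G g -> G (f \o g)) &
      (forall f, G f -> exists2 g, G g & cancel f g /\ cancel g f)].

Definition invariant (A : topologicalType) (G : set (A -> A)) (Y : set A) : Prop :=
  Y !=set0 /\ forall g y, G g -> Y y -> Y (g y).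

Definition has_invariant_chain (A : topologicalType) (G : set (A -> A)) (n : nat) : Prop :=
  exists Y : nat -> set A,
    [/\ (forall i, (i <= n)%N -> closed (Y i) /\ invariant G (Y i)),
        (forall i, (i < n)%N -> Y i `<` Y i.+1) &
        Y n = setT].

Definition height (R : realType) (A : topologicalType) (G : set (A -> A)) : \bar R :=
  ereal_sup [set ((n%:R)%:E : \bar R) | n in has_invariant_chain G].

Definition P_h (R : realType) (A : topologicalType) : set (\bar R) :=
  [set height R G | G in homeo_subgroup (A:=A)].

(* the unit circle S^1 as a subspace of R x R (subspace topology on set_type) *)
Definition circle_set (R : realType) : set (R * R)%type :=
  [set p | p.1 ^+ 2 + p.2 ^+ 2 = 1].
Definition S1 (R : realType) : topologicalType := (set_type (@circle_set R) : topologicalType).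
Arguments height R {A} G.
Arguments P_h R A _ : clear implicits.
Arguments S1 R.

(* Main.v *)
Require Import Defs.
From HB Require Import structures.
From mathcomp Require Import all_boot all_order all_algebra.
From mathcomp Require Import all_classical all_reals all_analysis.
From mathcomp Require Import ring lra zify.

(** The number of orbits bounds the length of a chain of closed invariant sets,
    so a group with exactly [n + 1] orbits that can be adjoined one by one, with
    closed unions, has height [n]. We take the stabilizer of a chain
    [Y_0 < ... < Y_n] of closed symmetric subsets of the circle cut out by lines
    through the origin: [Y_0] is [{v = 0}], and the next sets alternately adjoin
    a pair of lines [|v| = (k + 1) |u|] and the open arcs [k |u| < |v| < (k + 1) |u|];
    ending the process with or without the axis [u = 0] as a separate orbit
    produces both parities of [n]. Reflections bring any point to the first
    quadrant. There, two points of one layer lie in a common sector inside the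
    layer, and a positively homogeneous piecewise linear map of the plane,
    the identity off the sector, carries one to the other; normalized, it is a
    homeomorphism of the circle. The trivial group leaves all these chains
    invariant, so its height is infinite. *)

Set Implicit Arguments.
Unset Strict Implicit.
Unset Printing Implicit Defensive.
Import Order.TTheory GRing.Theory Num.Theory.
Local Open Scope classical_set_scope.
Local Open Scope ring_scope.
Import numFieldNormedType.Exports.

(** * Heights, and stabilizers of chains *)

Section Height.
Variables (R : realType) (A : topologicalType).
Implicit Types (G : set (A -> A)) (Y Z : nat -> set A).

Lemma has_invariant_chain0 G (a : A) : has_invariant_chain G 0.
Proof.
exists (fun=> setT); split=> // i _; split; first exact: closedT.
by split=> //; exists a.
Qed.

Lemma has_invariant_chain_leq G m n :
  (m <= n)%N -> has_invariant_chain G n -> has_invariant_chain G m.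
Proof.
(* Sets are dropped from the bottom, since the chain must still end at the whole space. *)
move=> mn [Y [Ycl Ylt Yn]]; exists (fun i => Y (i + (n - m))%N); split.
- by move=> i im; apply: Ycl; lia.
- by move=> i im; rewrite addSn; apply: Ylt; lia.
- by rewrite subnKC.
Qed.

Lemma height_ge G n : has_invariant_chain G n -> (n%:R%:E <= height R G)%E.
Proof. by move=> chain; apply: ereal_sup_ubound; exists n. Qed.

Lemma height_unbounded G :
  (forall n, has_invariant_chain G n) -> height R G = +oo%E.
Proof.
move=> chain; apply/eqyP => r r0; apply: le_trans (height_ge (chain (Num.truncn r).+1)).
by rewrite lee_fin ltW// truncnS_gt.
Qed.

Lemma height_eq G n : has_invariant_chain G n ->
  (forall m, has_invariant_chain G m -> (m <= n)%N) -> height R G = n%:R%:E.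
Proof.
move=> chain bound; apply/eqP; rewrite eq_le height_ge// andbT.
by apply: ge_ereal_sup => _ [m /bound mn <-]; rewrite lee_fin ler_nat.
Qed.

(** Possible chain lengths are closed downwards, so they are either all the naturals or bounded; in
    the latter case the supremum is a maximum. *)
Lemma height_nat_or_infty G (a : A) :
  (exists n, height R G = n%:R%:E) \/ height R G = +oo%E.
Proof.
have [chain|/existsNP[N noN]] := pselect (forall n, has_invariant_chain G n).
  by right; exact: height_unbounded.
left; have ex : exists n, `[< has_invariant_chain G n >].
  by exists 0%N; apply/asboolP/has_invariant_chain0.
have bound n : `[< has_invariant_chain G n >] -> (n <= N)%N.
  move=> /asboolP chain; rewrite leqNgt; apply/negP => /ltnW Nn.
  exact: noN (has_invariant_chain_leq Nn chain).
exists (ex_maxn ex bound); case: ex_maxnP => n /asboolP chain nmax.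
by apply: height_eq => // m /asboolP; exact: nmax.
Qed.

Lemma chain_mono Z n i j : (forall i, (i < n)%N -> Z i `<` Z i.+1) ->
  (i <= j)%N -> (j <= n)%N -> Z i `<=` Z j.
Proof.
move=> Zlt; elim: j => [|j IHj]; first by rewrite leqn0 => /eqP-> _ ?.
rewrite leq_eqVlt => /predU1P[-> _ ?|ij]//.
by move=> jn; exact: subset_trans (IHj ij (ltnW jn)) (properW (Zlt j jn)).
Qed.

(** An equivalence rather than an implication, so that inverses stay in the set. *)
Definition chain_stabilizer Y n : set (A -> A) :=
  [set g | homeomorphism g /\ forall i a, (i <= n)%N -> Y i (g a) <-> Y i a].

Lemma chain_stabilizer_subgroup Y n : homeo_subgroup (chain_stabilizer Y n).
Proof.
split.
- by move=> g [].
- split=> //; split; first by move=> ?; exact: cvg_id.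
  by exists id; split=> //; move=> ?; exact: cvg_id.
- move=> f g [[fc [f' [f'c fK f'K]]] fY] [[gc [g' [g'c gK g'K]]] gY]; split.
    split; first by move=> a; apply: continuous_comp; [exact: gc|exact: fc].
    exists (g' \o f'); split; [|exact: can_comp fK gK|exact: can_comp g'K f'K].
    by move=> a; apply: continuous_comp; [exact: f'c|exact: g'c].
  by move=> i a iN; rewrite /= fY// gY.
- move=> f [[fc [f' [f'c fK f'K]]] fY]; exists f' => //; split.
    by split=> //; exists f.
  by move=> i a iN; rewrite -fY// f'K.
Qed.

(* Each step of an invariant chain picks up a new orbit, and the orbits are the [n.+1] layers of [Y]. *)
Lemma height_chain_stabilizer Y n :
  (forall i, (i <= n)%N -> closed (Y i)) ->
  (forall i, (i < n)%N -> Y i `<` Y i.+1) ->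
  Y 0%N !=set0 -> Y n = setT ->
  (forall a b, (forall i, (i <= n)%N -> Y i a <-> Y i b) ->
     exists2 g, chain_stabilizer Y n g & g a = b) ->
  height R (chain_stabilizer Y n) = n%:R%:E.
Proof.
move=> Ycl Ylt [y0 Y0] Yn trans; apply: height_eq.
  exists Y; split=> // i iN; split; first exact: Ycl.
  split; first by exists y0; exact: (chain_mono Ylt (leq0n i) iN).
  by move=> g a [_ gY] Ya; apply/gY.
move=> m [Z [Zcl Zlt Zm]].
(* [lab a] will be the first index whose set contains [a]. As the chain increases, it determines
   membership in every [Y i], so points with equal labels share an orbit. *)
have exlab a : exists i, `[< Y i a >] by exists n; apply/asboolP; rewrite Yn.
pose lab a := ex_minn (exlab a).
have lab_le a : (lab a <= n)%N.
  by rewrite /lab; case: ex_minnP => k _; apply; apply/asboolP; rewrite Yn.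
have labP i a : (i <= n)%N -> Y i a <-> (lab a <= i)%N.
  rewrite /lab; case: ex_minnP => k /asboolP Yk kmin iN; split.
    by move=> /asboolP; exact: kmin.
  by move=> ki; exact: (chain_mono Ylt ki iN).
have new j : (j <= m)%N -> exists a, Z j a /\ forall i, (i < j)%N -> ~ Z i a.
  case: j => [|j] jm.
    by have [_ [[a Za] _]] := Zcl 0%N (leq0n m); exists a.
  have [_ /existsNP[a /not_implyP[Za nZa]]] := Zlt j jm.
  exists a; split=> // i ij /(chain_mono Zlt (ltnSE ij) (ltnW jm))//.
have /choice[z zP] (j : 'I_m.+1) :
    exists a, Z j a /\ forall i, (i < j)%N -> ~ Z i a.
  by apply: new; rewrite -ltnS.
pose f (j : 'I_m.+1) : 'I_n.+1 := inord (lab (z j)).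
suff finj : injective f by have := leq_card f finj; rewrite !card_ord.
(* With equal labels, some [g] in the group sends [z j] to [z k]; the invariant set [Z j] then
   contains [z k], which lies in no set of the chain before [Z k]. *)
have key (j k : 'I_m.+1) : (j < k)%N -> lab (z j) <> lab (z k).
  move=> jk E; have [|g Gg gz] := trans (z j) (z k).
    by move=> i iN; rewrite !labP// E.
  apply: ((zP k).2 j jk); rewrite -gz.
  have [_ [_]] := Zcl j (ltnSE (ltn_ord j)); apply => //; exact: (zP j).1.
move=> j k /(congr1 val); rewrite /= !inordK ?ltnS// => E; apply/val_inj/eqP.
by case: (ltngtP j k) => [/key|/key/nesym|].
Qed.

End Height.

(** * Circle maps from positively homogeneous maps of the plane *)

Section Circle.
Variable R : realType.
Implicit Types (p q r : R * R) (x y : S1 R).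

Definition dilate (c : R) p : R * R := (c * p.1, c * p.2).

Lemma dilateA c d p : dilate c (dilate d p) = dilate (c * d) p.
Proof. by rewrite /dilate/= !mulrA. Qed.

Lemma dilate1 p : dilate 1 p = p.
Proof. by case: p => u v; rewrite /dilate/= !mul1r. Qed.

Definition coord x : R * R := set_val x.

Lemma coordP x : (coord x).1 ^+ 2 + (coord x).2 ^+ 2 = 1.
Proof. exact: set_valP x. Qed.

Lemma coord_inj : injective coord.
Proof. exact: val_inj. Qed.

Lemma coord_continuous : continuous coord.
Proof. exact: initial_continuous. Qed.

Lemma on_circle p : p.1 ^+ 2 + p.2 ^+ 2 = 1 -> exists x, coord x = p.
Proof. by move=> p1; exists (SigSub (mem_set p1) : @circle_set R). Qed.

Lemma direction_eq (c : R) x y : 0 < c -> coord x = dilate c (coord y) -> x = y.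
Proof.
move=> c0 E; apply: coord_inj; suff c1 : c = 1 by rewrite E c1 dilate1.
have := coordP x; rewrite E /= !exprMn -mulrDr coordP mulr1 => /eqP.
by rewrite sqrf_eq1 => /orP[/eqP//|/eqP c1]; lra.
Qed.

Lemma direction_exists p : p <> (0, 0) ->
  exists2 x, coord x = dilate (Num.sqrt (p.1 ^+ 2 + p.2 ^+ 2))^-1 p &
    0 < (Num.sqrt (p.1 ^+ 2 + p.2 ^+ 2))^-1.
Proof.
case: p => u v /= p0; have N0 : 0 < u ^+ 2 + v ^+ 2.
  rewrite lt_neqAle addr_ge0 ?sqr_ge0// andbT eq_sym paddr_eq0 ?sqr_ge0//.
  by rewrite !sqrf_eq0; apply/negP => /andP[/eqP u0 /eqP v0]; apply: p0; rewrite u0 v0.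
have [|x xE] := @on_circle (dilate (Num.sqrt (u ^+ 2 + v ^+ 2))^-1 (u, v)).
  by rewrite /= !exprMn -mulrDr exprVn sqr_sqrtr ?ltW// mulVf ?gt_eqF.
by exists x => //; rewrite invr_gt0 sqrtr_gt0.
Qed.

Lemma normalize_continuous (T : topologicalType) (f1 f2 : T -> R) (t : T) :
  {for t, continuous f1} -> {for t, continuous f2} ->
  0 < Num.sqrt (f1 t ^+ 2 + f2 t ^+ 2) ->
  {for t, continuous (fun t =>
    dilate (Num.sqrt (f1 t ^+ 2 + f2 t ^+ 2))^-1 (f1 t, f2 t))}.
Proof.
move=> cf1 cf2 N0.
have cN : (Num.sqrt (f1 s ^+ 2 + f2 s ^+ 2))^-1 @[s --> t] -->
    (Num.sqrt (f1 t ^+ 2 + f2 t ^+ 2))^-1.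
  apply: cvgV; first by rewrite gt_eqF.
  apply: (@continuous_comp _ _ _ (fun s => f1 s ^+ 2 + f2 s ^+ 2) (@Num.sqrt R));
    last exact: sqrt_continuous.
  by apply: cvgD; apply: cvgM.
have c1 : (Num.sqrt (f1 s ^+ 2 + f2 s ^+ 2))^-1 * f1 s @[s --> t] -->
    (Num.sqrt (f1 t ^+ 2 + f2 t ^+ 2))^-1 * f1 t by exact: cvgM.
have c2 : (Num.sqrt (f1 s ^+ 2 + f2 s ^+ 2))^-1 * f2 s @[s --> t] -->
    (Num.sqrt (f1 t ^+ 2 + f2 t ^+ 2))^-1 * f2 t by exact: cvgM.
exact: cvg_pair c1 c2.
Qed.

(** The map is [F] followed by radial projection. This makes sense because [F] has no zero on the
    circle: [F'] is a left inverse of [F] and, by homogeneity with factor 0, fixes the origin. *)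
Lemma homogeneous_circle_map (F F' : R * R -> R * R) :
  continuous (fun p => (F p).1) -> continuous (fun p => (F p).2) ->
  (forall c p, 0 <= c -> F (dilate c p) = dilate c (F p)) ->
  (forall c p, 0 <= c -> F' (dilate c p) = dilate c (F' p)) ->
  cancel F F' ->
  exists2 g : S1 R -> S1 R, continuous g &
    forall x, exists2 c, 0 < c & coord (g x) = dilate c (F (coord x)).
Proof.
move=> F1 F2 Fh F'h FK.
pose N x := Num.sqrt ((F (coord x)).1 ^+ 2 + (F (coord x)).2 ^+ 2).
have Fn0 x : F (coord x) <> (0, 0).
  move=> /(congr1 F'); rewrite FK => E.
  have := F'h 0 (0, 0) (lexx 0); rewrite /dilate/= !mul0r -E => E0.
  by have := coordP x; rewrite E0/= expr0n/= addr0 => /eqP; rewrite eq_sym oner_eq0.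
have /choice[g gE] x : exists y, coord y = dilate (N x)^-1 (F (coord x)) /\ 0 < (N x)^-1.
  by have [y ? ?] := direction_exists (Fn0 x); exists y.
exists g; last first.
  by move=> x; have [E c0] := gE x; eexists; [exact: c0|exact: E].
apply: continuous_comp_initial => x.
have -> : set_val \o g = fun x => dilate (N x)^-1 ((F (coord x)).1, (F (coord x)).2).
  by apply/funext => y; rewrite [LHS](gE y).1; case: (F _).
apply: (@normalize_continuous (S1 R) (fun x => (F (coord x)).1) (fun x => (F (coord x)).2) x).
- by apply: (@continuous_comp _ _ _ coord (fun p => (F p).1)); [exact: coord_continuous|exact: F1].
- by apply: (@continuous_comp _ _ _ coord (fun p => (F p).2)); [exact: coord_continuous|exact: F2].
- by have [_] := gE x; rewrite invr_gt0.
Qed.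

(** By homogeneity the two normalized maps compose to a positive multiple of the identity, and two
    unit vectors that are positive multiples of each other coincide. *)
Lemma homogeneous_circle_homeo (F F' : R * R -> R * R) :
  continuous (fun p => (F p).1) -> continuous (fun p => (F p).2) ->
  continuous (fun p => (F' p).1) -> continuous (fun p => (F' p).2) ->
  (forall c p, 0 <= c -> F (dilate c p) = dilate c (F p)) ->
  (forall c p, 0 <= c -> F' (dilate c p) = dilate c (F' p)) ->
  cancel F F' -> cancel F' F ->
  exists2 g : S1 R -> S1 R, homeomorphism g &
    forall x, exists2 c, 0 < c & coord (g x) = dilate c (F (coord x)).
Proof.
move=> F1 F2 F'1 F'2 Fh F'h FK F'K.
have [g gc gE] := homogeneous_circle_map F1 F2 Fh F'h FK.
have [g' g'c g'E] := homogeneous_circle_map F'1 F'2 F'h Fh F'K.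
exists g => //; split=> //; exists g'; split=> // x.
  have [c c0 E] := gE x; have [c' c'0] := g'E (g x).
  rewrite E F'h ?(ltW c0)// FK dilateA; exact/direction_eq/mulr_gt0.
have [c c0 E] := g'E x; have [c' c'0] := gE (g' x).
rewrite E Fh ?(ltW c0)// F'K dilateA; exact/direction_eq/mulr_gt0.
Qed.

End Circle.

(** * Pushing one point to another inside a sector *)

Section Push.
Variable R : realType.
Implicit Types (a b p q r : R * R) (x y : S1 R).

Definition form a r : R := a.1 * r.1 + a.2 * r.2.

(** Cut out by two covectors rather than spanned by two rays, so that [a = b] is allowed and gives
    an open half-plane. *)
Definition sector a b r := 0 < form a r /\ 0 < form b r.

(** For [p] in the sector, this has value 1 at [p], vanishes off the sector, and is linear on each
    half cut out by the ray of [p]. *)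
Definition tent a b p r : R :=
  Num.max 0 (Num.min (form a r / form a p) (form b r / form b p)).

(* The identity off the sector; linear on each of the two halves into which the ray of [p] cuts it, with [p |-> q]. *)
Definition push a b p q r : R * R :=
  (r.1 + tent a b p r * (q.1 - p.1), r.2 + tent a b p r * (q.2 - p.2)).

Lemma form_push a a' b' p q r :
  form a (push a' b' p q r) = form a r + tent a' b' p r * (form a q - form a p).
Proof. rewrite /form /push /=; ring. Qed.

Lemma form_dilate a c r : form a (dilate c r) = c * form a r.
Proof. rewrite /form /dilate /=; ring. Qed.

Lemma sector_dilate a b c r : 0 < c -> sector a b (dilate c r) <-> sector a b r.
Proof. by move=> c0; rewrite /sector !form_dilate !pmulr_rgt0. Qed.

Lemma tent_dilate a b p c r : 0 <= c -> tent a b p (dilate c r) = c * tent a b p r.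
Proof.
by move=> c0; rewrite /tent !form_dilate -!mulrA -minr_pMr// -{1}(mulr0 c) -maxr_pMr.
Qed.

Lemma push_dilate a b p q c r : 0 <= c ->
  push a b p q (dilate c r) = dilate c (push a b p q r).
Proof. by move=> c0; rewrite /push tent_dilate// /dilate/= !mulrDr !mulrA. Qed.

Lemma tent_eq0 a b p r : sector a b p -> ~ sector a b r -> tent a b p r = 0.
Proof.
move=> [ap bp] out; apply/max_idPl; rewrite ge_min !ler_pdivrMr// !mul0r.
by rewrite !leNgt -negb_and; apply/negP => /andP.
Qed.

Lemma tent_gt0 a b p r : sector a b p -> sector a b r -> 0 < tent a b p r.
Proof. by move=> [ap bp] [ar br]; rewrite lt_max lt_min !divr_gt0 ?orbT. Qed.

Lemma push_out a b p q r : sector a b p -> ~ sector a b r -> push a b p q r = r.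
Proof.
by move=> sp /(tent_eq0 sp) E; rewrite /push E !mul0r !addr0; case: r {E}.
Qed.

(** Inside the sector, with [t] the tent at [r], each quotient [form c / form c q] at the pushed
    point is [t] plus a nonnegative term, which vanishes for the form attaining the minimum at [r].
    So the new minimum is again [t]. *)
Lemma tent_push a b p q r : sector a b p -> sector a b q ->
  tent a b q (push a b p q r) = tent a b p r.
Proof.
move=> sp sq; have [sr|nsr] := pselect (sector a b r); last first.
  by rewrite push_out// !tent_eq0.
have := tent_gt0 sp sr; have [[ap bp] [aq bq]] := (sp, sq).
rewrite [in LHS]/tent !form_push !mulrBr.
set t := tent _ _ _ _ => t0.
have shift c : 0 < form c p -> 0 < form c q ->
  (form c r + (t * form c q - t * form c p)) / form c q
  = t + (form c r / form c p - t) * (form c p / form c q).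
  by move=> cp cq; field; rewrite !gt_eqF.
rewrite !shift//.
have tE : t = Num.min (form a r / form a p) (form b r / form b p).
  by apply/max_r/ltW; have := t0; rewrite {1}/t/tent lt_max ltxx.
have pa : 0 < form a p / form a q by exact: divr_gt0.
have pb : 0 < form b p / form b q by exact: divr_gt0.
have [ab|ba] := leP (form a r / form a p) (form b r / form b p).
  have -> : t = form a r / form a p by rewrite tE min_l.
  rewrite subrr mul0r addr0 min_l ?max_r//; first by have [? _] := sr; exact/ltW/divr_gt0.
  by rewrite lerDl mulr_ge0// ?subr_ge0// ltW.
have -> : t = form b r / form b p by rewrite tE min_r// ltW.
rewrite subrr mul0r addr0 min_r ?max_r//; first by have [_ ?] := sr; exact/ltW/divr_gt0.
by rewrite lerDl mulr_ge0// ?subr_ge0// ltW.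
Qed.

(** The tent is preserved, so the way back subtracts the same multiple of [q - p]. *)
Lemma push_cancel a b p q : sector a b p -> sector a b q ->
  cancel (push a b p q) (push a b q p).
Proof.
move=> sp sq r; rewrite [LHS]/push tent_push//; case: r => u v /=.
by congr pair; ring.
Qed.

Lemma fst_cont : continuous (fst : R * R -> R).
Proof. by move=> r; exact: cvg_fst. Qed.

Lemma snd_cont : continuous (snd : R * R -> R).
Proof. by move=> r; exact: cvg_snd. Qed.

Lemma form_continuous a : continuous (form a).
Proof.
move=> r; apply: cvgD; apply: cvgM; try exact: cvg_cst.
  exact: fst_cont.
exact: snd_cont.
Qed.

Lemma tent_continuous a b p : continuous (tent a b p).
Proof.
move=> r.
have quot c : {for r, continuous (fun r => form c r / form c p : R^o)}.
  by apply: cvgM; [exact: form_continuous|exact: cvg_cst].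
exact: continuous_max (cvg_cst _) (continuous_min (quot a) (quot b)).
Qed.

Lemma push_continuous1 a b p q : continuous (fun r => (push a b p q r).1).
Proof.
move=> r; apply: cvgD; first exact: fst_cont.
by apply: cvgM; [exact: tent_continuous|exact: cvg_cst].
Qed.

Lemma push_continuous2 a b p q : continuous (fun r => (push a b p q r).2).
Proof.
move=> r; apply: cvgD; first exact: snd_cont.
by apply: cvgM; [exact: tent_continuous|exact: cvg_cst].
Qed.

Lemma push_homeo a b x y : sector a b (coord x) -> sector a b (coord y) ->
  exists g : S1 R -> S1 R, [/\ homeomorphism g, g x = y,
    forall z, sector a b (coord z) -> sector a b (coord (g z)) &
    forall z, ~ sector a b (coord z) -> g z = z].
Proof.
move=> sx sy; pose F := push a b (coord x) (coord y).
have [||||||||g gh gE] := @homogeneous_circle_homeo R F (push a b (coord y) (coord x)).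
- exact: push_continuous1.
- exact: push_continuous2.
- exact: push_continuous1.
- exact: push_continuous2.
- exact: push_dilate.
- exact: push_dilate.
- exact: push_cancel.
- exact: push_cancel.
exists g; split=> //.
- have [c c0 E] := gE x; apply: (direction_eq c0); rewrite E; congr dilate.
  have [[ax bx] _] := (sx, sy).
  (* The tent is 1 at its own peak, so [x] is moved exactly by the difference. *)
  rewrite /F /push /tent !divff ?gt_eqF// minxx max_r// !mul1r !subrKC.
  by case: (coord y).
- move=> z sz; have [c c0 ->] := gE z; apply/sector_dilate => //.
  (* The sector is where the tent is positive, and the push carries the tent of [x] to that of
     [y]. *)
  have /= := tent_gt0 sx sz; rewrite -(tent_push _ sx sy) -/F => t0.
  by apply: contrapT => /(tent_eq0 sy) E; rewrite E ltxx in t0.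
- move=> z nsz; have [c c0] := gE z; rewrite /F push_out//; exact: direction_eq.
Qed.

Lemma signs_homeo (s t : R) : s ^+ 2 = 1 -> t ^+ 2 = 1 ->
  exists2 g : S1 R -> S1 R, homeomorphism g &
    forall x, coord (g x) = (s * (coord x).1, t * (coord x).2).
Proof.
move=> s1 t1; pose F r := (s * r.1, t * r.2).
have F1 : continuous (fun r : R * R => (F r).1).
  by move=> r; apply: cvgM; [exact: cvg_cst|exact: fst_cont].
have F2 : continuous (fun r : R * R => (F r).2).
  by move=> r; apply: cvgM; [exact: cvg_cst|exact: snd_cont].
have Fh c r : 0 <= c -> F (dilate c r) = dilate c (F r).
  by move=> _; rewrite /F /dilate /= mulrCA [t * _]mulrCA.
have FK : cancel F F.
  by case=> u v; rewrite /F /= !mulrA -!expr2 s1 t1 !mul1r.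
have [g gh gE] := homogeneous_circle_homeo F1 F2 F1 F2 Fh Fh FK FK.
exists g => // x; have [c c0 E] := gE x; rewrite E.
(* The image is already a unit vector, so normalization changes nothing. *)
have [y yE] : exists y : S1 R, coord y = F (coord x).
  by apply: on_circle; rewrite /= !exprMn s1 t1 !mul1r coordP.
by rewrite -/(F (coord x)) -yE; rewrite -yE in E; rewrite -E (direction_eq c0 E).
Qed.

End Push.

(** * The chain of layers *)

Section Layers.
Variable R : realType.
Implicit Types (r : R * R) (x y : S1 R).

(* With [k = i./2]: for even [i] the double cone [|v| <= k |u|]; for odd [i]
   this cone plus the lines [|v| = k.+1 |u|], which are replaced by the axis
   [u = 0] in the last but one layer. *)
Definition layer (n i : nat) r : Prop :=
  (n <= i)%N \/ `|r.2| <= i./2%:R * `|r.1| \/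
  (odd i /\ if i.+1 == n then r.1 = 0 else `|r.2| = i./2.+1%:R * `|r.1|).

Definition circle_layer n i : set (S1 R) := [set x | layer n i (coord x)].

Lemma parity_split i : exists k, i = k.*2 \/ i = k.*2.+1.
Proof. by exists i./2; lia. Qed.

Lemma half_odd k : k.*2.+1./2 = k. Proof. lia. Qed.

Lemma layer_dilate n i c r : 0 < c -> layer n i (dilate c r) <-> layer n i r.
Proof.
move=> c0; rewrite /layer /dilate /= !normrM (gtr0_norm c0) ![_ * (c * _)]mulrCA.
rewrite ler_pM2l//; have cinj := mulfI (lt0r_neq0 c0).
have -> : (c * r.1 = 0) = (r.1 = 0).
  by apply/propext; split=> [/eqP|->]; rewrite ?mulr0// mulf_eq0 gt_eqF//= => /eqP.
have -> // : (c * `|r.2| = c * (i./2.+1%:R * `|r.1|)) = (`|r.2| = i./2.+1%:R * `|r.1|).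
by apply/propext; split=> [|->//]; exact: cinj.
Qed.

Lemma layer_norm n i r s :
  `|r.1| = `|s.1| -> `|r.2| = `|s.2| -> layer n i r <-> layer n i s.
Proof.
move=> E1 E2; rewrite /layer E1 E2.
have -> // : (r.1 = 0) = (s.1 = 0).
have Z : (r.1 == 0) = (s.1 == 0) by rewrite -normr_eq0 E1 normr_eq0.
by apply/propext; split=> /eqP; [rewrite Z|rewrite -Z] => /eqP.
Qed.

(** For odd [i] the extra lines have slope [i./2.+1 <= k]; the bound [k.*2 < n] excludes both the
    whole plane and the axis. *)
Lemma layer_low n i k r : k%:R * `|r.1| < `|r.2| ->
  (k.*2 < n)%N -> (i <= k.*2)%N -> ~ layer n i r.
Proof.
move=> kr kn ik; have low m : (m <= k)%N -> m%:R * `|r.1| < `|r.2|.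
  by move=> mk; apply: le_lt_trans kr; rewrite ler_wpM2r// ler_nat.
case=> [|[|[oi]]]; first by lia.
  by rewrite leNgt low//; lia.
case: eqP => [|_ E]; first by lia.
have /low : (i./2.+1 <= k)%N by lia.
by rewrite E ltxx.
Qed.

Lemma layer_high n i k r : `|r.2| <= k%:R * `|r.1| -> (k.*2 <= i)%N -> layer n i r.
Proof.
move=> kr ki; right; left; apply: le_trans kr _.
by rewrite ler_wpM2r// ler_nat; lia.
Qed.

Lemma layer_double n k r : (k.*2 < n)%N ->
  layer n k.*2 r <-> `|r.2| <= k%:R * `|r.1|.
Proof.
move=> kn; split=> [|kr]; last exact: layer_high kr (leqnn _).
by rewrite /layer doubleK odd_double => -[|[//|[]//]]; lia.
Qed.

Lemma layer_doubleS n k r : (k.*2.+1 < n)%N ->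
  layer n k.*2.+1 r <-> `|r.2| <= k%:R * `|r.1| \/
    (if k.*2.+2 == n then r.1 = 0 else `|r.2| = k.+1%:R * `|r.1|).
Proof.
move=> kn; rewrite /layer half_odd /= odd_double; split.
  by case=> [|[|[]]]; [lia|left|right].
by case; [right; left|right; right].
Qed.

Lemma layer_closed n i : closed [set r | layer n i r].
Proof.
have [ni|ni] := leqP n i.
  suff -> : [set r | layer n i r] = setT by exact: closedT.
  by apply/seteqP; split=> // r _; left.
have c1 : continuous (fun r : R * R => `|r.1|).
  by move=> r; apply: cvg_norm; exact: fst_cont.
have c2 : continuous (fun r : R * R => `|r.2|).
  by move=> r; apply: cvg_norm; exact: snd_cont.
have ck k : continuous (fun r : R * R => `|r.2| - k%:R * `|r.1|).
  move=> r; apply: cvgB; first exact: c2.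
  by apply: cvgM; [exact: cvg_cst|exact: c1].
have cone k : closed [set r : R * R | `|r.2| <= k%:R * `|r.1|].
  have -> : [set r : R * R | `|r.2| <= k%:R * `|r.1|] =
      (fun r => `|r.2| - k%:R * `|r.1|) @^-1` [set z | z <= 0].
    by apply/funext => r /=; rewrite subr_le0.
  exact: (continuous_closedP _).1 (ck k) _ (closed_le (y := 0)).
have lines k : closed [set r : R * R | `|r.2| = k%:R * `|r.1|].
  have -> : [set r : R * R | `|r.2| = k%:R * `|r.1|] =
      (fun r => `|r.2| - k%:R * `|r.1|) @^-1` [set z | z = 0].
    by apply/seteqP; split=> r /= => [->|/subr0_eq//]; rewrite subrr.
  exact: (continuous_closedP _).1 (ck k) _ (closed_eq (y := 0)).
have axis : closed [set r : R * R | r.1 = 0].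
  exact: (continuous_closedP _).1 (@fst_cont R) _ (closed_eq (y := 0)).
have [k [ik|ik]] := parity_split i; subst i.
  suff -> : [set r | layer n k.*2 r] = [set r | `|r.2| <= k%:R * `|r.1|] by [].
  by apply/funext => r; apply/propext; exact: layer_double.
suff -> : [set r | layer n k.*2.+1 r] = [set r | `|r.2| <= k%:R * `|r.1|] `|`
    [set r | if k.*2.+2 == n then r.1 = 0 else `|r.2| = k.+1%:R * `|r.1|].
  by apply: closedU; [exact: cone|case: (_ == n); [exact: axis|exact: lines]].
by apply/funext => r; apply/propext; exact: layer_doubleS.
Qed.

Lemma circle_layer_closed n i : closed (circle_layer n i).
Proof.
exact: (continuous_closedP _).1 (@coord_continuous R) _ (@layer_closed n i).
Qed.

(** Layers are unions of rays, so witnesses can be given as nonzero vectors of any length. *)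
Lemma circle_layer_witness n i r : r <> (0, 0) -> layer n i r ->
  exists2 x, circle_layer n i x & forall j, circle_layer n j x <-> layer n j r.
Proof.
move=> /direction_exists[x xE c0] ir.
have E j : circle_layer n j x <-> layer n j r.
  by rewrite /circle_layer /= xE; exact: layer_dilate.
by exists x => //; apply/E.
Qed.

Lemma circle_layer0 n : circle_layer n 0 !=set0.
Proof.
have [||x] := @circle_layer_witness n 0 (1, 0); last by exists x.
  by move=> [/eqP]; rewrite oner_eq0.
by right; left; rewrite /= normr0 mul0r.
Qed.

Lemma circle_layerT n : circle_layer n n = setT.
Proof. by apply/seteqP; split=> // x _; left. Qed.

Lemma circle_layer_proper n i : (i < n)%N -> circle_layer n i `<` circle_layer n i.+1.
Proof.
move=> iN; split=> [x|sub].
  have [k [ik|ik]] := parity_split i; subst i.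
    by move=> /(layer_double _ iN) /layer_high; apply.
  have [->|n2] := eqVneq k.*2.+2 n; first by left.
  move=> /(layer_doubleS _ iN); rewrite (negPf n2) => -[/layer_high|E].
    by apply; lia.
  by apply: (@layer_high _ _ k.+1); [rewrite E|lia].
suff [r [r0 Sr nr]] : exists r, [/\ r <> (0, 0), layer n i.+1 r & ~ layer n i r].
  by have [x /sub xi xE] := circle_layer_witness r0 Sr; exact/nr/xE.
have n1 : (1 : R) <> 0 by exact/eqP/oner_neq0.
have k0 k : 0 <= k%:R :> R by exact: ler0n.
have [k [ik|ik]] := parity_split i; subst i.
  have [nk|nk] := leqP n k.*2.+2.
    (* If [n] is [k.*2.+1] the next layer is everything; if it is [k.*2.+2] the next layer adjoins
       the axis. Either way [(0, 1)] is new. *)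
    exists (0, 1); split=> //=; first by case.
      have [?|?] := leqP n k.*2.+1; first by left.
      apply/layer_doubleS => //; right.
      by rewrite ifT//=; lia.
    by apply: (@layer_low _ _ k) => //=; rewrite normr0 mulr0 normr1.
  exists (1, k.+1%:R); split=> //=; first by case.
    by apply/layer_doubleS; [lia|right; rewrite ifF/= ?normr1 ?mulr1 ?normr_nat//; lia].
  by apply: (@layer_low _ _ k) => //=; rewrite normr1 mulr1 normr_nat ltr_nat.
(* A slope strictly between [k] and [k.+1], hence off the lines or axis just adjoined. *)
exists (1, k%:R + 2^-1); split=> //=; first by case.
  apply: (@layer_high _ _ k.+1) => /=; last by lia.
  by rewrite normr1 mulr1 ger0_norm ?addr_ge0 ?invr_ge0 ?ler0n// -(@natr1 R k); have := k0 k; lra.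
move=> /(layer_doubleS _ iN) /=; rewrite normr1 !mulr1 ger0_norm ?addr_ge0 ?invr_ge0 ?ler0n//.
case=> [|]; first by lra.
by case: ifP => _ //; rewrite -(@natr1 R k); lra.
Qed.

Definition layer_group n := chain_stabilizer (circle_layer n) n.

(** [P] records which layers contain the sector; no layer cuts it. A push then respects all layers,
    as it preserves the sector and fixes every point outside. *)
Lemma sector_trans n (P : nat -> Prop) (a b : R * R) x y :
  sector a b (coord x) -> sector a b (coord y) ->
  (forall i z, (i <= n)%N -> sector a b (coord z) -> circle_layer n i z <-> P i) ->
  exists2 g, layer_group n g & g x = y.
Proof.
move=> sx sy SP; have [g [gh gx gin gout]] := push_homeo sx sy.
exists g => //; split=> // i z iN.
have [sz|nsz] := pselect (sector a b (coord z)); last by rewrite gout.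
by rewrite !(SP i)//; exact: gin.
Qed.

Lemma to_first_quadrant n x : exists2 g, layer_group n g &
  coord (g x) = (`|(coord x).1|, `|(coord x).2|).
Proof.
have sign (w : R) : exists2 s : R, s ^+ 2 = 1 & s * w = `|w|.
  exists ((-1) ^+ (w < 0)%R); first by rewrite sqrr_sign.
  by rewrite normrEsign.
have [[s s1 sE] [t t1 tE]] := (sign (coord x).1, sign (coord x).2).
have [g gh gE] := signs_homeo s1 t1; exists g; last by rewrite gE sE tE.
split=> // i z _; rewrite /circle_layer /= gE; apply: layer_norm => /=.
  by rewrite normrM -[`|s|]sqrtr_sqr s1 sqrtr1 mul1r.
by rewrite normrM -[`|t|]sqrtr_sqr t1 sqrtr1 mul1r.
Qed.

End Layers.

(** * Transitivity on the points new in a layer *)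

(** The equation of the circle becomes [(1 + K ^+ 2) * u ^+ 2 = 1], which determines [u >= 0]. *)
Lemma proportional_eq (R : realType) (K : R) (x y : S1 R) :
  0 <= (coord x).1 -> 0 <= (coord y).1 ->
  (coord x).2 = K * (coord x).1 -> (coord y).2 = K * (coord y).1 -> x = y.
Proof.
move=> x0 y0 xK yK; have := (coordP x, coordP y); rewrite xK yK => -[Ex Ey].
have K0 : 0 < 1 + K ^+ 2 by have := sqr_ge0 K; lra.
have E : (coord x).1 = (coord y).1.
  apply/eqP; rewrite -(@eqrXn2 _ 2)//; apply/eqP/(mulfI (lt0r_neq0 K0)).
  by transitivity (1 : R); [rewrite -[RHS]Ex|rewrite -[LHS]Ey]; ring.
apply: coord_inj; move: xK yK E; case: (coord x) => u v; case: (coord y) => u' v' /=.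
by move=> -> -> ->.
Qed.

(** Let [i] be the least index of a layer containing the points. In the quadrant, the points new at
    [i] either reduce to one, so [x = y], or lie in an open sector all of whose points are new at
    [i], so a push applies. *)
Lemma layer_trans_quadrant (R : realType) n (x y : S1 R) :
  0 <= (coord x).1 -> 0 <= (coord x).2 -> 0 <= (coord y).1 -> 0 <= (coord y).2 ->
  (forall i, (i <= n)%N -> circle_layer n i x <-> circle_layer n i y) ->
  exists2 g, layer_group n g & g x = y.
Proof.
move=> x1 x2 y1 y2 xy.
have [_ G1 _ _] := @chain_stabilizer_subgroup (S1 R) (circle_layer n) n.
suff [->|//] : x = y \/ exists2 g, layer_group n g & g x = y by exists id.
have [i [iN ix iy imin]] : exists i, [/\ (i <= n)%N, circle_layer n i x,
    circle_layer n i y & forall j, (j < i)%N ->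
      ~ circle_layer n j x /\ ~ circle_layer n j y].
  have ex : exists i, `[< circle_layer n i x >] by exists n; apply/asboolP; left.
  case: (ex_minnP ex) => i /asboolP ix imin.
  have iN : (i <= n)%N by apply: imin; apply/asboolP; left.
  exists i; split=> //; first exact/xy.
  move=> j ji; have nx : ~ circle_layer n j x.
    by move=> jx; have := imin j (asboolT jx); lia.
  by split=> // jy; apply/nx/xy => //; lia.
have cone_out k (z : S1 R) : (k.*2 < n)%N -> 0 <= (coord z).1 -> 0 <= (coord z).2 ->
    ~ circle_layer n k.*2 z -> k%:R * (coord z).1 < (coord z).2.
  move=> kn z1 z2 nz; rewrite ltNge; apply/negP => le; apply/nz/layer_double => //.
  by rewrite !ger0_norm.
have [k E] := parity_split i.
move: iN; rewrite leq_eqVlt => /predU1P[iE|iN]; last first.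
  case: E => E; subst i.
    case: k => [|k] in iN ix iy imin *.
      (* The bottom layer meets the quadrant only in [(1, 0)]. *)
      left; move: ix iy => /(layer_double _ iN) + /(layer_double _ iN).
      rewrite !mul0r !normr_le0 => /eqP xE /eqP yE.
      by apply: (@proportional_eq _ 0); rewrite ?mul0r.
    (* New are the slopes strictly between [k] and [k.+1]: by [kn2] the preceding layer adjoined the
       lines of slope [k.+1], not the axis. *)
    right; have kn : (k.*2 < n)%N by lia.
    have kn1 : (k.*2.+1 < n)%N by lia.
    have kn2 : (k.*2.+2 == n) = false by lia.
    have inside (z : S1 R) : 0 <= (coord z).1 -> 0 <= (coord z).2 ->
        circle_layer n k.+1.*2 z -> ~ circle_layer n k.*2 z ->
        ~ circle_layer n k.*2.+1 z ->
        sector (- k%:R, 1) (k.+1%:R, -1) (coord z).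
      move=> z1 z2 /(layer_double _ iN); rewrite !ger0_norm// => zi nz nz'.
      rewrite /sector /form /=; have := cone_out k z kn z1 z2 nz.
      split; first by lra.
      suff : (coord z).2 < k.+1%:R * (coord z).1 by lra.
      rewrite lt_neqAle zi andbT; apply/eqP => E; apply: nz'.
      by apply/layer_doubleS => //; right; rewrite kn2 !ger0_norm.
    have [|nx ny] := imin k.*2; first by lia.
    have [|nx' ny'] := imin k.*2.+1; first by lia.
    apply: (@sector_trans _ _ (fun j => (k.+1.*2 <= j)%N) (- k%:R, 1) (k.+1%:R, -1)); [exact: inside..|].
    move=> j z jn; rewrite /sector /form /= => -[kz zk1].
    (* The two forms of the sector add up to the first coordinate. *)
    have u0 : 0 < (coord z).1 by move: zk1; rewrite -(@natr1 R k); lra.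
    have v0 : 0 < (coord z).2.
      by apply: le_lt_trans (_ : k%:R * (coord z).1 < _); [rewrite mulr_ge0// ltW|lra].
    split=> [jz|]; last first.
      by apply: layer_high; rewrite !gtr0_norm//; lra.
    have low : k%:R * `|(coord z).1| < `|(coord z).2| by rewrite !gtr0_norm//; lra.
    rewrite leqNgt; apply/negP => jk.
    have [jk2|jk2] := leqP j k.*2; first exact: layer_low low kn jk2 jz.
    have E : j = k.*2.+1 by lia.
    move: jz; rewrite E => /(layer_doubleS _ kn1).
    by rewrite kn2 !gtr0_norm// => -[|]; lra.
  (* Beyond the cone of slope [k] only lines or the axis were adjoined, giving one point of the
     quadrant. *)
  left; have kn : (k.*2 < n)%N by lia.
  have [nx ny] := imin k.*2 (ltnSn _).
  have xk := cone_out k x kn x1 x2 nx; have yk := cone_out k y kn y1 y2 ny.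
  have xE : if k.*2.+2 == n then (coord x).1 = 0
            else (coord x).2 = k.+1%:R * (coord x).1.
    by move: ix => /(layer_doubleS _ iN); rewrite !ger0_norm// => -[|//]; lra.
  have yE : if k.*2.+2 == n then (coord y).1 = 0
            else (coord y).2 = k.+1%:R * (coord y).1.
    by move: iy => /(layer_doubleS _ iN); rewrite !ger0_norm// => -[|//]; lra.
  case: ifP xE yE => _ xE yE; last exact: proportional_eq xE yE.
  have := (coordP x, coordP y); rewrite xE yE expr0n /= !add0r => -[/eqP Ex /eqP Ey].
  rewrite !sqrp_eq1// in Ex Ey.
  apply: coord_inj; move: xE yE Ex Ey; case: (coord x) => u v; case: (coord y) => u' v' /=.
  by move=> -> -> /eqP-> /eqP->.
right; subst i; case: E => E.
  case: k => [|k] in E *.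
    (* Here [n = 0] and the whole circle is the only layer; the closed quadrant lies in the
       half-plane [u + v > 0]. *)
    have pos (z : S1 R) : 0 <= (coord z).1 -> 0 <= (coord z).2 ->
        sector (1, 1) (1, 1) (coord z).
      by move=> z1 z2; have := coordP z; rewrite /sector /form /=; split; nra.
    apply: (@sector_trans _ _ (fun=> True) (1, 1) (1, 1)); [exact: pos..|].
    by move=> j z _ _; split=> // _; left; rewrite E.
  (* For even [n] the axis entered one layer earlier, so the last sector stops at it; this is the
     covector [(1, 0)]. *)
  have kn : (k.*2 < n)%N by lia.
  have kn1 : (k.*2.+1 < n)%N by lia.
  have kn2 : k.*2.+2 == n by lia.
  have inside (z : S1 R) : 0 <= (coord z).1 -> 0 <= (coord z).2 ->
      ~ circle_layer n k.*2 z -> ~ circle_layer n k.*2.+1 z ->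
      sector (- k%:R, 1) (1, 0) (coord z).
    move=> z1 z2 nz nz'; rewrite /sector /form /=; have := cone_out k z kn z1 z2 nz.
    split; first by lra.
    suff : 0 < (coord z).1 by lra.
    rewrite lt_neqAle z1 andbT eq_sym; apply/eqP => z0; apply: nz'.
    by apply/layer_doubleS => //; right; rewrite kn2.
  have [[nx ny] [nx' ny']] := (imin _ kn, imin _ kn1).
  apply: (@sector_trans _ _ (fun j => (n <= j)%N) (- k%:R, 1) (1, 0)); [exact: inside..|].
  move=> j z _; rewrite /sector /form /= => -[kz z0].
  have u0 : 0 < (coord z).1 by lra.
  have v0 : 0 < (coord z).2.
    by apply: le_lt_trans (_ : k%:R * (coord z).1 < _); [rewrite mulr_ge0// ltW|lra].
  have low : k%:R * `|(coord z).1| < `|(coord z).2| by rewrite !gtr0_norm//; lra.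
  split=> [jz|nj]; last by left.
  rewrite leqNgt; apply/negP => jn.
  have [jk2|jk2] := leqP j k.*2; first exact: layer_low low kn jk2 jz.
  have Ej : j = k.*2.+1 by lia.
  move: jz; rewrite Ej => /(layer_doubleS _ kn1).
  by rewrite kn2 !gtr0_norm// => -[|]; lra.
(* For odd [n] the axis is never adjoined separately: the last sector [v > k |u|] straddles it, and
   [u] may have either sign there. *)
have kn : (k.*2 < n)%N by lia.
have inside (z : S1 R) : 0 <= (coord z).1 -> 0 <= (coord z).2 ->
    ~ circle_layer n k.*2 z -> sector (- k%:R, 1) (k%:R, 1) (coord z).
  move=> z1 z2 nz; rewrite /sector /form /=; have := cone_out k z kn z1 z2 nz.
  have : 0 <= k%:R * (coord z).1 by rewrite mulr_ge0.
  by split; lra.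
have [nx ny] := imin k.*2 kn.
apply: (@sector_trans _ _ (fun j => (n <= j)%N) (- k%:R, 1) (k%:R, 1)); [exact: inside..|].
move=> j z _; rewrite /sector /form /= => -[za zb].
have low : k%:R * `|(coord z).1| < `|(coord z).2|.
  rewrite -[k%:R * _]ger0_norm ?mulr_ge0// normrM normr_id -normrM.
  apply: lt_le_trans (ler_norm _); rewrite ltr_norml; apply/andP; split; lra.
split=> [jz|nj]; last by left.
by rewrite leqNgt; apply/negP => jn; apply: layer_low low kn _ jz; lia.
Qed.

(** Both points are reflected into the first quadrant and joined there; then the second reflection
    is undone. *)
Lemma layer_trans (R : realType) n (x y : S1 R) :
  (forall i, (i <= n)%N -> circle_layer n i x <-> circle_layer n i y) ->
  exists2 g, layer_group n g & g x = y.
Proof.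
move=> xy; have [_ _ Gcomp Ginv] := @chain_stabilizer_subgroup (S1 R) (circle_layer n) n.
have [[g Gg gx] [h Gh hy]] := (to_first_quadrant n x, to_first_quadrant n y).
have [||||i iN|f Gf fE] := @layer_trans_quadrant R n (g x) (h y).
- by rewrite gx normr_ge0.
- by rewrite gx normr_ge0.
- by rewrite hy normr_ge0.
- by rewrite hy normr_ge0.
- by rewrite (Gg.2 i)// (Gh.2 i)//; exact: xy.
have [h' Gh' [hK _]] := Ginv h Gh.
by exists (h' \o (f \o g)); [apply: (Gcomp) => //; exact: Gcomp|rewrite /= fE hK].
Qed.

(** * The heights that occur *)

Lemma height_layer_group (R : realType) n :
  height R (layer_group (R := R) n) = n%:R%:E.
Proof.
apply: height_chain_stabilizer.
- by move=> i _; exact: circle_layer_closed.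
- exact: circle_layer_proper.
- exact: circle_layer0.
- exact: circle_layerT.
- exact: layer_trans.
Qed.

Lemma height_trivial_group (R : realType) :
  height R [set (id : S1 R -> S1 R)] = +oo%E.
Proof.
apply: height_unbounded => n; exists (circle_layer n); split.
- move=> i iN; split; first exact: circle_layer_closed.
  split; last by move=> _ y -> .
  have [y y0] := circle_layer0 R n; exists y.
  exact: (chain_mono (@circle_layer_proper R n) (leq0n i) iN).
- exact: circle_layer_proper.
- exact: circle_layerT.
Qed.

Lemma trivial_subgroup (A : topologicalType) : homeo_subgroup [set (id : A -> A)].
Proof.
split=> [_ ->| //|_ _ -> -> //|_ ->]; last by exists id.
by split=> [x|]; [exact: cvg_id|exists id; split=> // x; exact: cvg_id].
Qed.

Theorem theorem3p1 (R : realType) :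
  P_h R (S1 R) = [set x : \bar R | (exists n : nat, x = (n%:R)%:E) \/ x = +oo%E].
Proof.
apply/seteqP; split=> [_ [G _ <-]|_ [[n ->]|->]].
(* A point of the circle is needed to have a chain of length 0. *)
- by have [a _] := circle_layer0 R 0; exact: height_nat_or_infty.
- by exists (layer_group n); [exact: chain_stabilizer_subgroup|exact: height_layer_group].
- by exists [set id]; [exact: trivial_subgroup|exact: height_trivial_group].
Qed.
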